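(* Let $k\geq 1$ be an integer and let $G$ be a profinite group such that $|x|_k<\infty$ for every $x\in G$. Then $\gamma_{k+1}(G)$ is finite.
   Context: For elements of a group, $[x,y]=x^{-1}y^{-1}xy$, and $[x_1,\dots,x_k]=[\dots[[x_1,x_2],x_3]\dots,x_k]$ denotes the left-normed commutator. For a group $G$, an element $a\in G$ and an integer $k\geq 1$, $|a|_k$ denotes the cardinality of the set $\{[a,x_1,\dots,x_k] : x_1,\dots,x_k\in G\}$. $\gamma_i(G)$ denotes the $i$th term of the lower central series of $G$ (with $\gamma_1(G)=G$), i.e. the subgroup generated by all commutators $[x_1,\dots,x_i]$ with $x_j\in G$. *)

(* Defs.v *)
From HB Require Import structures.
From mathcomp Require Import all_boot.
From mathcomp Require Import boolp classical_sets cardinality topology.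

Set Implicit Arguments.
Unset Strict Implicit.
Unset Printing Implicit Defensive.

Local Open Scope classical_set_scope.
Local Open Scope group_scope.

HB.mixin Record isTopologicalGroup G of Group G & Topological G := {
  mulg_continuous : continuous (fun xy : G * G => xy.1 * xy.2);
  invg_continuous : continuous (fun x : G => x^-1)
}.

#[short(type="topologicalGroupType")]
HB.structure Definition TopologicalGroup :=
  {G of Group G & Topological G & isTopologicalGroup G}.

Definition profinite (G : topologicalGroupType) : Prop :=
  [/\ compact [set: G], hausdorff_space G & totally_disconnected [set: G]].

(* [a, x_1, ..., x_k] = [...[[a, x_1], x_2], ..., x_k]; the empty commutator is
   set to 1. The library's [~ x, y] is x^-1 * y^-1 * x * y. *)
Definition left_comm (G : groupType) (s : seq G) : G :=
  if s is a :: x then foldl (fun u v => [~ u, v]) a x else 1.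

(* The set whose cardinality is |a|_k. *)
Definition left_comms (G : groupType) (k : nat) (a : G) : set G :=
  range (fun x : k.-tuple G => left_comm (a :: x)).

Definition subgroup_generated (G : groupType) (S : set G) : set G :=
  smallest (fun H : set G => group_closed [in H]) S.

(* gamma_i(G); meaningful for i >= 1, with gamma_1(G) = G. *)
Definition lower_central (G : groupType) (i : nat) : set G :=
  subgroup_generated (range (fun x : i.-tuple G => left_comm x)).
Arguments lower_central : clear implicits.

(* Main.v *)
Require Import Defs.
From HB Require Import structures.
From mathcomp Require Import all_boot.
From mathcomp Require Import boolp classical_sets cardinality topology.

(** Let [Z_n] be the upper central series of [G]; an element [a] lies in [Z_n]
    exactly when [[a, x_1, ..., x_n] = 1] for all [x_i].

    The hypothesis makes [G / Z_{k-1}] a group with open centralizers. Fix [x].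
    The set of all [[x, y, x_2, ..., x_k]] is finite, hence discrete, and
    contains 1. By compactness there is a neighbourhood of 1 such that, for [y]
    in it, all these commutators equal 1, whatever [x_2, ..., x_k] are. That
    is, [[x, y]] lies in [Z_{k-1}] ([nbhs_centralizer]).

    A compact Hausdorff group in which centralizers are open modulo a closed
    normal subgroup has an open centre modulo that subgroup ([nbhs_center]).
    Indeed every element has finitely many conjugates modulo the subgroup, and
    the set of elements with fewer than [n] of them is closed. By Baire's
    theorem, some such set has interior; for the least such [n] there is a
    point [a] of the interior around which the number of conjugates is exactly
    [n - 1]. Near [a] the conjugates then stay apart, so that an element near
    [a] has no conjugate close to it but itself: it commutes with all elements
    near 1. Hence two neighbourhoods of 1 commute with each other, and
    compactness replaces one of them by the whole group.

    So [Z_k] contains a neighbourhood of 1 and has finite index, and Baer's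
    theorem says that [gamma_{k+1}] is finite ([finite_lower_series]). Its proof
    is by induction on [k], through [G / Z_1]: the group [gamma_k] is finite
    modulo the centre and commutes with [Z_k] ([commute_lower_upper]), so there
    are finitely many commutators [c = [u, y]] with [u] in [gamma_k]. Some power
    [c^m] lies in [Z_k], hence commutes with [u], and then
    [c^(m+1) = (c^m)^u c = (c^u)^(m-1) c^u c = (c^u)^(m-1) [u^2, y]]
    is a product of [m] commutators of this kind. A finite set stable under
    conjugation with such relations generates a finite group
    ([finite_subgroup_generated]). *)

Set Implicit Arguments.
Unset Strict Implicit.
Unset Printing Implicit Defensive.

Local Open Scope classical_set_scope.
Local Open Scope group_scope.

(** * Quotients and commutators *)

Definition normal_subgroup (G : groupType) (N : set G) :=
  [/\ N 1, forall x y, N x -> N y -> N (x^-1 * y) &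
      forall x y, N x -> N (x ^ y)].

Section Quotient.
Variables (G : groupType) (N : set G).

(** The cosets are bare sets with classical equality and choice; the group
    structure is given to them inside the proof below, as it needs [N] to be
    normal. *)
Definition left_cosets := {A : set G | exists x, A = [set y | N (x^-1 * y)]}.

HB.instance Definition _ := gen_eqMixin left_cosets.
HB.instance Definition _ := gen_choiceMixin left_cosets.

(** Working in [Q] turns congruences modulo [N] into equalities; a surjective
    morphism with kernel [N] is the interface to the quotient. *)
Lemma quotient_exists : normal_subgroup N ->
  exists (Q : groupType) (pi : UMagmaMorphism.type G Q),
    (forall q, exists x, pi x = q) /\ (forall x, pi x = 1 <-> N x).
Proof.
move=> [N1 NVM NJ].
pose cl x : left_cosets := exist _ [set y | N (x^-1 * y)] (ex_intro _ x erefl).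
have clP x y : cl x = cl y <-> N (x^-1 * y).
  split=> [/(congr1 sval)/= exy | Nxy].
    suff: [set z | N (x^-1 * z)] y by [].
    by rewrite exy /= mulVg.
  apply: eq_exist; apply/seteqP; split=> z /= Nz.
    by have := NVM _ _ Nxy Nz; rewrite !gnorm.
  suff: N ((x^-1 * y)^-1^-1 * (y^-1 * z)) by rewrite !gnorm.
  by apply: (NVM) => //; rewrite -[_^-1]mulg1; apply: (NVM).
pose repr (A : left_cosets) : G := projT1 (cid (projT2 A)).
have reprK A : cl (repr A) = A.
  rewrite /repr; case: (cid _) => x /= eA.
  by case: A eA => A pA /= eA; apply: eq_exist.
pose mulQ A B := cl (repr A * repr B).
pose invQ A := cl (repr A)^-1.
have clM x y : mulQ (cl x) (cl y) = cl (x * y).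
  have /clP Nx := reprK (cl x); have /clP Ny := reprK (cl y).
  apply/clP; suff: N ((((repr (cl x))^-1 * x) ^ repr (cl y))^-1^-1 *
    ((repr (cl y))^-1 * y)) by rewrite /conjg !gnorm.
  by apply: (NVM) => //; rewrite -[_^-1]mulg1; apply: (NVM) => //; apply: (NJ).
have clV x : invQ (cl x) = cl x^-1.
  have /clP Nx := reprK (cl x).
  apply/clP; suff: N (((repr (cl x))^-1 * x) ^ x^-1)^-1.
    by rewrite /conjg !gnorm.
  by rewrite -[_^-1]mulg1; apply: (NVM) => //; apply: (NJ).
have mulA : associative mulQ.
  by move=> A B C; rewrite -[A]reprK -[B]reprK -[C]reprK !clM mulgA.
have mul1 : left_id (cl 1) mulQ by move=> A; rewrite -[A]reprK clM mul1g.
have mul1r : right_id (cl 1) mulQ by move=> A; rewrite -[A]reprK clM mulg1.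
have mulV : left_inverse (cl 1) invQ mulQ.
  by move=> A; rewrite -[A]reprK clV clM mulVg.
have mulVr : right_inverse (cl 1) invQ mulQ.
  by move=> A; rewrite -[A]reprK clV clM mulgV.
pose Q : groupType :=
  HB.pack left_cosets (isGroup.Build left_cosets mulA mul1 mul1r mulV mulVr).
have morph_cl : monoid_morphism (cl : G -> Q).
  by split=> // x y; rewrite -clM.
pose pi : UMagmaMorphism.type G Q :=
  HB.pack (cl : G -> Q) (isUMagmaMorphism.Build G Q cl morph_cl).
exists Q, pi; split=> [A | x]; first by exists (repr A); apply: reprK.
by split=> [/esym/clP | Nx]; [rewrite !gnorm | apply/esym/clP; rewrite !gnorm].
Qed.

End Quotient.

Section CommutatorIdentities.
Variable G : groupType.
Implicit Types x y z : G.

Lemma commMg x y z : [~ x * y, z] = [~ x, z] ^ y * [~ y, z].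
Proof. by rewrite /commg /conjg !gnorm. Qed.

Lemma commVg x z : [~ x^-1, z] = ([~ x, z] ^ x^-1)^-1.
Proof. by rewrite /commg /conjg !gnorm. Qed.

Lemma invg_commg x y : [~ x, y]^-1 = [~ x, y^-1] ^ y.
Proof. by rewrite /commg /conjg !gnorm. Qed.

Lemma comm_mull_center u p y : (forall z, commute p z) -> [~ u * p, y] = [~ u, y].
Proof.
by move=> pC; rewrite commMg /conjg -pC mulKg (eqP (introT commgP (pC y))) mulg1.
Qed.

Lemma comm_mulr_commute u q y : commute u q -> [~ u, q * y] = [~ u, y].
Proof.
by move=> uq; rewrite /commg /conjg !invgM !mulgA -(mulgA _ u q) uq !gnorm.
Qed.

End CommutatorIdentities.

Fixpoint upper_central (G : groupType) n : set G :=
  if n is m.+1 then [set a | forall x, upper_central m [~ a, x]] else [set 1].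

Fixpoint lower_series (G : groupType) n : set G :=
  if n is m.+1 then
    subgroup_generated [set [~ u, y] | u in lower_series m & y in [set: G]]
  else setT.
Arguments upper_central : clear implicits.
Arguments lower_series : clear implicits.

(** * Upper and lower central series *)

Section Generated.
Variable G : groupType.
Implicit Types S H : set G.

Lemma subgroup_generated_ind S H : H 1 -> (forall x y, H x -> H y -> H (x / y)) ->
  S `<=` H -> subgroup_generated S `<=` H.
Proof.
move=> H1 HB SH; apply: smallest_sub => //; split; first exact/mem_set.
by move=> x y /set_mem Hx /set_mem Hy; apply/mem_set/HB.
Qed.

Lemma sub_subgroup_generated S : S `<=` subgroup_generated S.
Proof. exact: sub_smallest. Qed.

Lemma subgroup_generated1 S : subgroup_generated S 1.
Proof. by move=> H [[/set_mem H1 _] _]. Qed.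

Lemma subgroup_generatedB S x y : subgroup_generated S x ->
  subgroup_generated S y -> subgroup_generated S (x / y).
Proof.
move=> Sx Sy H [[H1 HB] SH]; apply/set_mem/HB; apply/mem_set; [exact: Sx|exact: Sy].
Qed.

End Generated.

Section Series.
Variable G : groupType.

Lemma upper_central_normal n : normal_subgroup (upper_central G n).
Proof.
elim: n => [|n [U1 UVM UJ]] /=.
  split=> [|_ _ -> ->|_ y ->] //; first by rewrite !gnorm.
  by rewrite conj1g.
have UV x : upper_central G n x -> upper_central G n x^-1.
  by move=> Ux; rewrite -[_^-1]mulg1; apply: (UVM).
split=> [x|x y Ux Uy z|x y Ux z] /=; first by rewrite comm1g.
  rewrite commMg commVg -conjVg.
  suff: upper_central G n ((([~ x, z] ^ x^-1) ^ y)^-1 * [~ y, z]).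
    by rewrite !conjVg.
  by apply: (UVM) => //; apply: (UJ); apply: (UJ).
by rewrite -[z](conjgKV y) -conjRg; apply: (UJ).
Qed.

Lemma upper_central1 p : upper_central G 1 p -> forall z, commute p z.
Proof. by move=> Zp z; apply/commgP/eqP/Zp. Qed.

Lemma lower_series1 n : lower_series G n 1.
Proof. by case: n => [|n] //=; apply: subgroup_generated1. Qed.

Lemma lower_seriesB n x y :
  lower_series G n x -> lower_series G n y -> lower_series G n (x / y).
Proof. by case: n => [|n] //=; apply: subgroup_generatedB. Qed.

Lemma lower_seriesM n x y :
  lower_series G n x -> lower_series G n y -> lower_series G n (x * y).
Proof.
move=> Lx Ly; rewrite -[y]invgK; apply: lower_seriesB => //.
by rewrite -[y^-1]mul1g; apply: lower_seriesB => //; apply: lower_series1.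
Qed.

Lemma lower_series_comm n u y : lower_series G n u -> lower_series G n.+1 [~ u, y].
Proof. by move=> Lu; apply: sub_subgroup_generated; exists u => //; exists y. Qed.

Lemma lower_series_conj n x g : lower_series G n x -> lower_series G n (x ^ g).
Proof.
elim: n x => [|n IHn] // x.
apply: (@subgroup_generated_ind _ _ [set x | lower_series G n.+1 (x ^ g)]).
- by rewrite /= conj1g; apply: (lower_series1 n.+1).
- move=> {}x y Lx Ly; rewrite /mkset conjMg conjVg.
  exact: (@lower_seriesB n.+1).
- move=> _ [u Lu [y _ <-]]; rewrite /mkset conjRg.
  by apply: lower_series_comm; apply: IHn.
Qed.

Lemma left_comm_lower_series n (x : n.+1.-tuple G) : lower_series G n (left_comm x).
Proof.
case/tupleP: x => a x /=.
suff H j b (s : seq G) : lower_series G j b ->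
    lower_series G (size s + j) (foldl (fun u v => [~ u, v]) b s).
  by have /= := H 0 a x I; rewrite size_tuple addn0.
elim: s j b => [|y s IHs] j b Lb; first exact: Lb.
by rewrite [size _]/= addSnnS; apply: IHs; apply: lower_series_comm.
Qed.

Lemma lower_central_sub n : lower_central G n.+1 `<=` lower_series G n.
Proof.
apply: subgroup_generated_ind; first exact: lower_series1.
- exact: lower_seriesB.
- by move=> _ [x _ <-]; apply: left_comm_lower_series.
Qed.

End Series.

Lemma upper_central_morph (G Q : groupType) (pi : UMagmaMorphism.type G Q) n x :
  (forall q, exists x, pi x = q) -> (forall x, upper_central G 1 x -> pi x = 1) ->
  upper_central G n.+1 x -> upper_central Q n (pi x).
Proof.
move=> pi_surj pi1; elim: n x => [|n IHn] x Ux; first exact: pi1.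
by move=> q; have [y <-] := pi_surj q; rewrite -gmulfR; apply: IHn.
Qed.

Lemma lower_series_morph (G Q : groupType) (pi : UMagmaMorphism.type G Q) n x :
  lower_series G n x -> lower_series Q n (pi x).
Proof.
elim: n x => [|n IHn] // x.
apply: (@subgroup_generated_ind _ _ [set x | lower_series Q n.+1 (pi x)]).
- by rewrite /mkset gmulf1; apply: (lower_series1 _ n.+1).
- by move=> {}x y Lx Ly; rewrite /mkset gmulfF; apply: (@lower_seriesB _ n.+1).
- move=> _ [u Lu [y _ <-]]; rewrite /mkset gmulfR.
  by apply: lower_series_comm; apply: IHn.
Qed.

(** The classical inclusion of [[gamma_{n+1}, Z_{n+1}]] in the trivial group.
    Conjugation by [z] multiplies [u] by an element [p] that is central, by
    induction in the quotient by the centre, and [y] on the left by an element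
    [q] of [Z_{n+1}] (the index having dropped by one), which commutes with [u]
    by induction in [G]. Neither [p] nor [q] changes the commutator [[u, y]],
    so [z] fixes it. *)
Lemma commute_lower_upper n (G : groupType) (u z : G) :
  lower_series G n u -> upper_central G n.+1 z -> commute u z.
Proof.
elim: n G u z => [|n IHn] G u z; first by move=> _ /upper_central1 Cz; apply/commute_sym/Cz.
move=> + Uz; apply: (@subgroup_generated_ind _ _ [set u | commute u z]).
- exact/commute_sym/commute1.
- move=> {}u v /commute_sym zu /commute_sym zv.
  by apply/commute_sym/commuteM => //; apply: commuteV.
move=> _ [{}u Lu [y _ <-]]; rewrite /mkset; apply/commgP; rewrite -conjg_fix; apply/eqP.
have [Q [pi [pi_surj piP]]] := quotient_exists (upper_central_normal G 1).
have Cp : upper_central G 1 (u^-1 * u ^ z).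
  apply/piP; rewrite gmulfM gmulfV gmulfJ -[X in X = _]/([~ pi u, pi z]).
  apply/eqP/commgP/IHn; first exact: lower_series_morph.
  by apply: upper_central_morph => // x /piP.
have uq : commute u (y ^ z * y^-1).
  apply: (IHn) => //.
  have -> : y ^ z * y^-1 = [~ z, y^-1] by rewrite /commg /conjg !gnorm.
  exact: Uz.
rewrite conjRg -[u ^ z](mulVKg u) comm_mull_center; last exact: upper_central1.
by rewrite -[y ^ z](mulgVK y) comm_mulr_commute.
Qed.

(** * Finite generation by words of bounded length *)

Section Words.
Variables (G : groupType) (s : seq G).
Hypothesis sJ : forall x y : G, x \in s -> x ^ y \in s.

(** Moving a copy of [c] to the front of a word conjugates the letters that it
    passes, which stay in [s] and keep their number. *)
Lemma gather_letter (c : G) n (w : seq G) : {subset w <= s} -> n <= count_mem c w ->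
  exists w' : seq G, [/\ {subset w' <= s}, size w' + n = size w &
    \prod_(x <- w) x = c ^+ n * \prod_(x <- w') x].
Proof.
elim: w n => [|x w IHw] n ws /=.
  by rewrite leqn0 => /eqP->; exists [::]; rewrite expg0 mul1g.
have [xs {}ws] : x \in s /\ {subset w <= s}.
  by split=> [|y wy]; apply: ws; rewrite inE ?eqxx ?wy ?orbT.
case: n => [|n] lenw.
  exists (x :: w); rewrite expg0 mul1g addn0; split=> // y.
  by rewrite inE => /predU1P[->|/ws].
have [exc|nxc] := eqVneq x c.
  have [|w' [w's <- ew]] := IHw n ws; first by move: lenw; rewrite exc eqxx.
  by exists w'; rewrite addnS big_cons ew exc expgS mulgA.
have [|w' [w's sw ew]] := IHw n.+1 ws; first by move: lenw; rewrite (negPf nxc).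
exists (x ^ (c ^+ n.+1) :: w'); split; last first.
- by rewrite !big_cons ew mulgA (conjgC x) -mulgA.
- by rewrite /= addSn sw.
by move=> y; rewrite inE => /predU1P[->|/w's//]; apply: (sJ).
Qed.

Lemma frequent_letter M (w : seq G) : {subset w <= s} -> size s * M < size w ->
  exists2 c, c \in s & M <= count_mem c w.
Proof.
move=> ws ltw; apply: contrapT => noc; move: ltw; apply/negP; rewrite -leqNgt.
have -> : size w = \sum_(x <- w) \sum_(c <- undup s) (x == c).
  rewrite -sum1_size big_seq [RHS]big_seq; apply: eq_bigr => x wx.
  rewrite (bigD1_seq x) ?mem_undup ?undup_uniq ?ws //= eqxx big1 ?addn0 // => c.
  by rewrite eq_sym => /negPf->.
rewrite exchange_big /=.
apply: (@leq_trans (\sum_(c <- undup s) M)).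
  rewrite [leqLHS]big_seq [leqRHS]big_seq; apply: leq_sum => c.
  rewrite mem_undup => sc.
  rewrite leqNgt; apply/negP => ltM; apply: noc; exists c => //.
  apply: leq_trans (ltnW ltM) _.
  by rewrite -sum1_count [leqRHS]big_mkcond /=; apply: leq_sum => x _; case: eqP.
by rewrite big_const_seq count_predT iter_addn_0 mulnC leq_mul2r size_undup orbT.
Qed.

Hypothesis s_short : forall c, c \in s -> exists n (w : seq G),
  [/\ size w < n, {subset w <= s} & c ^+ n = \prod_(x <- w) x].

(** In a long word some letter [c] occurs at least [n c] times; these copies are
    gathered and the power that they form is replaced by a shorter word. *)
Lemma bounded_words : exists B, forall w : seq G, {subset w <= s} ->
  exists w' : seq G, [/\ {subset w' <= s}, size w' <= B &
    \prod_(x <- w) x = \prod_(x <- w') x].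
Proof.
have /choice[n nP] : forall c, exists n, c \in s -> exists w : seq G,
    [/\ size w < n, {subset w <= s} & c ^+ n = \prod_(x <- w) x].
  move=> c; have [sc|_] := boolP (c \in s); last by exists 0.
  by have [n ?] := s_short sc; exists n.
exists (size s * \max_(c <- s) n c)%N => w.
have [m] := ubnP (size w); elim: m w => // m IHm w ltwm ws.
have [|/(frequent_letter ws)[c sc]] := leqP (size w) (size s * \max_(c <- s) n c).
  by exists w.
have lenc : n c <= \max_(c <- s) n c by apply: leq_bigmax_seq.
move=> /(leq_trans lenc)/(gather_letter ws)[w2 [w2s sw ->]].
have [w1 [sw1 w1s ->]] := nP c sc.
rewrite -big_cat; apply: IHm; last first.
  by move=> x; rewrite mem_cat => /orP[/w1s|/w2s].
by rewrite -ltnS; apply: leq_trans ltwm; rewrite ltnS size_cat -sw addnC ltn_add2l.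
Qed.

End Words.

Lemma finite_words (G : groupType) (s : seq G) B :
  finite_set [set \prod_(x <- w) x | w in [set w | {subset w <= s} /\ size w <= B]].
Proof.
elim: B => [|B IHB].
  apply: (@sub_finite_set _ _ [set 1]); last exact: finite_set1.
  by move=> _ [w [_ +] <-]; rewrite leqn0 => /nilP->; rewrite big_nil.
apply: (@sub_finite_set _ _ ([set 1] `|` [set x * y | x in [set` s] & y in
  [set \prod_(x <- w) x | w in [set w : seq G | {subset w <= s} /\ size w <= B]]])).
  move=> _ [[|x w] [ws sw] <-]; first by left; rewrite big_nil.
  right; exists x; first by apply: ws; rewrite inE eqxx.
  exists (\prod_(x <- w) x); last by rewrite big_cons.
  by exists w => //; split=> // y wy; apply: ws; rewrite inE wy orbT.
by rewrite finite_setU; split; [exact: finite_set1 | apply: finite_image2].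
Qed.

(** A form of Dietzmann's lemma. The relations that shorten powers replace the
    usual assumption that the generators have finite order. *)
Lemma finite_subgroup_generated (G : groupType) (X : set G) : finite_set X ->
  (forall x y, X x -> X (x ^ y)) -> (forall x, X x -> X x^-1) ->
  (forall c, X c -> exists n (w : seq G),
    [/\ size w < n, {in w, forall x, X x} & c ^+ n = \prod_(x <- w) x]) ->
  finite_set (subgroup_generated X).
Proof.
move=> /finite_seqP[s ->] sJ sV s_short.
have [B BP] := bounded_words sJ s_short.
apply: (sub_finite_set _ (finite_words s B)).
apply: subgroup_generated_ind.
- by exists [::]; rewrite ?big_nil.
- move=> _ _ [v [vs _] <-] [w [ws _] <-].
  have [|w' [w's sw ew]] := BP (v ++ rev (map inv w)).
    move=> x; rewrite mem_cat mem_rev => /orP[/vs //|/mapP[y /ws sy ->]].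
    exact: sV.
  exists w' => //; rewrite -ew big_cat /=; congr (_ * _).
  by rewrite -map_rev big_map prodgV revK.
move=> x sx; have [|w' [w's sw ew]] := BP [:: x].
  by move=> y; rewrite inE => /eqP->.
by exists w'; rewrite // -ew big_seq1.
Qed.

(** * Baer's theorem *)

(** For a subgroup this means finite index; it also applies to the
    neighbourhoods of 1 in a compact group. *)
Definition syndetic (G : groupType) (H : set G) :=
  exists s : seq G, forall g, exists2 t, t \in s & H (t^-1 * g).

Lemma seq_pigeonhole (I : finType) (T : eqType) (f : I -> T) (s : seq T) :
  (forall i, f i \in s) -> size s < #|I| -> exists i j, i != j /\ f i = f j.
Proof.
move=> fs lts; apply: contrapT => noc; move: lts; apply/negP; rewrite -leqNgt.
rewrite cardE -(size_map f) uniq_leq_size //.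
  rewrite map_inj_in_uniq ?enum_uniq // => i j _ _ eij.
  by apply: contrapT => /eqP nij; apply: noc; exists i, j.
by move=> _ /mapP[i _ ->].
Qed.

Lemma syndetic_expg (G : groupType) (H : set G) (g : G) : normal_subgroup H ->
  syndetic H -> exists m, H (g ^+ m.+1).
Proof.
move=> [H1 HVM _] [s sP].
have /choice[r rP] : forall i : nat, exists t, t \in s /\ H (t^-1 * g ^+ i).
  by move=> i; have [t ? ?] := sP (g ^+ i); exists t.
have [|i [j [nij er]]] := @seq_pigeonhole 'I_(size s).+1 _ r s (fun i => (rP i).1).
  by rewrite card_ord.
wlog ltij : i j nij er / i < j.
  by move=> IH; move: (nij); rewrite neq_ltn => /orP[]; apply: IH; rewrite // eq_sym.
exists (j - i).-1; rewrite prednK ?subn_gt0//.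
have := HVM _ _ (rP i).2 (rP j).2; rewrite er !gnorm.
by rewrite -{1}(subnKC (ltnW ltij)) expgnDr mulKg.
Qed.

(** The induction passes to the quotient by the centre, which lowers [n] and
    shows that the previous term of the lower series is finite modulo the
    centre; hence the next one has finitely many generators. *)
Theorem finite_lower_series n (G : groupType) :
  syndetic (upper_central G n) -> finite_set (lower_series G n).
Proof.
elim: n G => [|n IHn] G [s sP].
  apply: (@sub_finite_set _ _ [set` s]); last exact: finite_seq.
  move=> g _; have [t st /= e] := sP g.
  by rewrite /mkset -[g](mulVKg t) e mulg1.
have [Q [pi [pi_surj piP]]] := quotient_exists (upper_central_normal G 1).
have piU x : upper_central G n.+1 x -> upper_central Q n (pi x).
  by apply: upper_central_morph => // y /piP.
have finL : finite_set (lower_series Q n).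
  apply: IHn; exists (map pi s) => q; have [g <-] := pi_surj q.
  have [t st Ut] := sP g; exists (pi t); first exact: map_f.
  by rewrite -gmulfV -gmulfM; apply: piU.
have [_ _ UJ] := upper_central_normal G n.+1.
have [r rK] := choice pi_surj.
have Lcomm u z := @commute_lower_upper n G u z.
apply: finite_subgroup_generated.
- apply: (sub_finite_set _ (finite_image2 (fun q t => [~ r q, t]) finL (finite_seq s))).
  (* [[u, y]] depends only on [u] modulo the centre and on [y] modulo
     [Z_{n+1}], which commutes with [u]. *)
  move=> _ [u Lu [y _ <-]]; exists (pi u); first exact: lower_series_morph.
  have [t st Ut] := sP y; exists t => //.
  have -> : y = (t^-1 * y) ^ t^-1 * t by rewrite /conjg !gnorm.
  rewrite comm_mulr_commute; last exact/Lcomm/UJ.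
  rewrite -[u in RHS](mulVKg (r (pi u))) comm_mull_center //.
  apply/upper_central1/piP.
  by rewrite gmulfM gmulfV rK mulVg.
- move=> _ g [u Lu [y _ <-]]; rewrite conjRg.
  by exists (u ^ g); [apply: lower_series_conj | exists (y ^ g)].
- move=> _ [u Lu [y _ <-]]; rewrite invg_commg conjRg.
  by exists (u ^ y); [apply: lower_series_conj | exists (y^-1 ^ y)].
move=> _ [u Lu [y _ <-]]; set c := [~ u, y].
have [|m Um] := @syndetic_expg _ _ c (upper_central_normal G n.+1).
  by exists s.
(* [c^(m+2) = (c^u)^m [u^2, y]], because [u] fixes [c^(m+1)]. *)
exists m.+2, (rcons (nseq m (c ^ u)) [~ u * u, y]); split.
- by rewrite size_rcons size_nseq.
- move=> x; rewrite mem_rcons inE => /predU1P[->|/nseqP[-> _]].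
    by exists (u * u); [apply: lower_seriesM | exists y].
  by rewrite conjRg; exists (u ^ u); [apply: lower_series_conj | exists (y ^ u)].
have cu : (c ^+ m.+1) ^ u = c ^+ m.+1.
  by apply/conjg_fixP; rewrite commg1_sym; apply/commgP/Lcomm.
rewrite -cats1 big_cat big_seq1 /= big_nseq iter_mulg_1 commMg -/c.
by rewrite [RHS]mulgA -expgSr -conjXg cu -expgSr.
Qed.

(** * Compact groups *)

Lemma compact_baire (T : topologicalType) (E : nat -> set T) (x0 : T) :
  compact [set: T] -> hausdorff_space T -> (forall n, closed (E n)) ->
  (forall x, exists n, E n x) -> exists n, (E n)° !=set0.
Proof.
move=> Tcompact Thausdorff Eclosed Ecover; apply: contrapT => Eempty.
have shrink (n : nat) (U : set T) : exists V : set T, open U -> U !=set0 ->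
    [/\ open V, V !=set0 & closure V `<=` U `\` E n].
  have [[oU U0]|nU] := pselect (open U /\ U !=set0); last first.
    by exists set0 => oU U0; case: nU.
  have oUE : open (U `\` E n) by apply: openI => //; exact: closed_openC.
  have [x UEx] : U `\` E n !=set0.
    apply: contrapT => UE0; apply: Eempty; exists n; case: U0 => x Ux; exists x.
    rewrite /interior; move/open_nbhs_nbhs: (conj oU Ux); apply: filterS => y Uy.
    by apply: contrapT => nEy; apply: UE0; exists y.
  have [|V Vx VUE] := @compact_regular T x _ Thausdorff Tcompact filterT (U `\` E n).
    exact: open_nbhs_nbhs.
  exists V° => _ _; split; [exact: open_interior | by exists x |].
  by apply: subset_trans VUE; apply: closureS; exact: interior_subset.
have /choice[f fP] : forall p : nat * set T, exists V : set T,
    open p.2 -> p.2 !=set0 -> [/\ open V, V !=set0 & closure V `<=` p.2 `\` E p.1].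
  by move=> p; apply: shrink.
pose A := fix A n := if n is m.+1 then f (m, A m) else [set: T].
have AP n : open (A n) /\ A n !=set0.
  elim: n => [|n [oA A0]] /=; first by split; [exact: openT | exists x0].
  by have [] := fP (n, A n) oA A0.
have AS n : closure (A n.+1) `<=` A n `\` E n.
  by have [] := fP (n, A n) (AP n).1 (AP n).2.
have Amono m n : m <= n -> A n `<=` A m.
  move=> /subnK <-; elim: (n - m) => [|d IHd] //.
  by apply: subset_trans IHd => x /subset_closure/AS[].
pose F := filter_from [set: nat] A.
have FP : ProperFilter F.
  apply: filter_from_proper => [|n _]; last exact: (AP n).2.
  apply: filter_from_filter; first by exists 0.
  move=> m n _ _; exists (maxn m n) => // x Ax.
  by split; apply: Amono Ax; rewrite ?leq_maxl ?leq_maxr.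
have [x [_ ]] := Tcompact F FP filterT; rewrite clusterE => xA.
have [n Enx] := Ecover x.
by have /AS[] := xA (A n.+1) (ex_intro2 _ _ n.+1 I (fun y => id)).
Qed.

Section TopologicalGroup.
Variable G : topologicalGroupType.
Implicit Types O N : set G.

Lemma continuous_mulg (T : topologicalType) (f g : T -> G) :
  continuous f -> continuous g -> continuous (fun x => f x * g x).
Proof.
move=> cf cg x; apply: (@continuous2_cvg _ _ _ _ _ _ f g (fun a b => a * b)) => //.
- exact: (@mulg_continuous G (f x, g x)).
- exact: cf.
- exact: cg.
Qed.

Lemma continuous_invg (T : topologicalType) (f : T -> G) :
  continuous f -> continuous (fun x => (f x)^-1).
Proof. by move=> cf x; apply: continuous_comp; [apply: cf | apply: invg_continuous]. Qed.

Lemma continuous_conjg (T : topologicalType) (f g : T -> G) :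
  continuous f -> continuous g -> continuous (fun x => f x ^ g x).
Proof.
move=> cf cg; apply: continuous_mulg; first exact: continuous_invg.
exact: continuous_mulg.
Qed.

Lemma continuous_commg (T : topologicalType) (f g : T -> G) :
  continuous f -> continuous g -> continuous (fun x => [~ f x, g x]).
Proof.
move=> cf cg; apply: continuous_mulg; first exact: continuous_invg.
exact: continuous_conjg.
Qed.

Lemma continuous_const (T : topologicalType) (a : T) : continuous (fun _ : T => a).
Proof. by move=> x; apply: cvg_cst. Qed.

Lemma nbhs_translate (a : G) N : nbhs 1 N -> nbhs a [set x | N (a^-1 * x)].
Proof.
move=> N1; have := @continuous_mulg _ _ _ (@continuous_const _ a^-1) (fun=> @cvg_id _ _) a.
by apply; rewrite mulVg.
Qed.

Lemma compact_syndetic N : compact [set: G] -> nbhs 1 N -> syndetic N.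
Proof.
move=> /compact_near_coveringP Gcov N1.
pose F := filter_from [set: seq G] (fun s => [set s' : seq G | {subset s <= s'}]).
have FF : Filter F.
  apply: filter_from_filter; first by exists [::].
  move=> s t _ _; exists (s ++ t) => // r str.
  by split=> x xr; apply: str; rewrite mem_cat xr ?orbT.
have [|s _ sP] := Gcov _ F (fun s g => exists2 t, t \in s & N (t^-1 * g)) FF.
  move=> x _; exists ([set y | N (x^-1 * y)], [set s : seq G | {subset [:: x] <= s}]) => /=.
    by split; [exact: nbhs_translate | exists [:: x]].
  by move=> [y s] /= [Nxy sx]; exists x => //; apply: sx; rewrite inE.
by exists s => g; apply: (sP s (fun x => id) g).
Qed.

(** The tube lemma, for one variable: by compactness the openness in [a] is
    uniform in [x]. *)
Lemma open_comm_into O : compact [set: G] -> open O -> open [set a | forall x, O [~ a, x]].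
Proof.
move=> /compact_near_coveringP Gcov; rewrite openE => Oo a Oa.
have cc : continuous (fun p : G * G => [~ p.2, p.1]).
  by apply: continuous_commg => p; [exact: cvg_snd | exact: cvg_fst].
have nO := Gcov G (nbhs a) (fun a x => O [~ a, x]) (nbhs_filter a)
  (fun x _ => cc (x, a) O (Oo _ (Oa x))).
by rewrite /interior; apply: filterS nO => b Ob x; apply: Ob.
Qed.

Lemma open_comms_into O n : compact [set: G] -> open O ->
  open [set a | forall s : seq G, size s = n -> O (foldl (fun u v => [~ u, v]) a s)].
Proof.
move=> Gcompact oO; elim: n => [|n IHn].
  congr open: oO; apply/seteqP; split=> a /= Oa; first by case.
  exact: (Oa [::]).
congr open: (open_comm_into Gcompact IHn).
apply/seteqP; split=> a /= Oa; first by case=> // x s [sn]; apply: Oa.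
by move=> x s sn; apply: (Oa (x :: s)); rewrite /= sn.
Qed.

Lemma upper_centralP n (a : G) : upper_central G n a <->
  forall s : seq G, size s = n -> foldl (fun u v => [~ u, v]) a s = 1.
Proof.
elim: n a => [|n IHn] a /=.
  by split=> [-> []// | /(_ [::] erefl)].
split=> [Ua [|x s]// [sn]|a1 x]; first exact: (IHn _).1 (Ua x) s sn.
by apply/IHn => s sn; apply: (a1 (x :: s)); rewrite /= sn.
Qed.

(** The commutators [[x, y, x_2, ..., x_{n+1}]] avoid, for [y] near 1, the
    finite set of the values other than 1, hence are all equal to 1. The open set
    given by [open_comms_into] makes this uniform in the [x_i]. *)
Lemma nbhs_centralizer n (x : G) : compact [set: G] -> hausdorff_space G ->
  finite_set (left_comms n.+1 x) -> nbhs 1 [set y | upper_central G n [~ x, y]].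
Proof.
move=> Gcompact Ghausdorff finL.
have oO : open (~` (left_comms n.+1 x `\ 1)).
  apply: closed_openC; have := hausdorff_accessible Ghausdorff.
  by move/accessible_finite_set_closed; apply; exact: finite_setD.
pose W := [set a | forall s : seq G, size s = n ->
  (~` (left_comms n.+1 x `\ 1)) (foldl (fun u v => [~ u, v]) a s)].
have W1 : nbhs [~ x, 1] W.
  apply: open_nbhs_nbhs; split; first exact: open_comms_into.
  rewrite commg1 => s _ [_]; apply.
  by elim: s => //= y s IHs; rewrite comm1g.
have : nbhs 1 [set y | W [~ x, y]].
  exact: @continuous_commg _ _ _ (@continuous_const _ x) (fun=> @cvg_id _ _) 1 W W1.
apply: filterS => y Wy; apply/upper_centralP => s sn.
apply: contrapT => s1; apply: (Wy s sn); split=> //.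
have sz : size (y :: s) == n.+1 by rewrite /= sn.
by exists (Tuple sz).
Qed.

Lemma closed_upper_central n : hausdorff_space G -> closed (upper_central G n).
Proof.
move=> Ghausdorff; elim: n => [|n IHn].
  exact/accessible_closed_set1/hausdorff_accessible.
have -> : upper_central G n.+1 =
    \bigcap_(x in [set: G]) [set a | upper_central G n [~ a, x]].
  by apply/seteqP; split=> a Ua x => [_|]; apply: Ua.
apply: closed_bigI => x _; move: IHn; apply: (continuous_closedP _).1.
by apply: continuous_commg; [move=> y; apply: cvg_id | apply: continuous_const].
Qed.

(** * Compact groups with open centralizers modulo a closed kernel *)

Section FC.
Variables (Q : groupType) (pi : UMagmaMorphism.type G Q).
Hypotheses (Gcompact : compact [set: G]) (Ghausdorff : hausdorff_space G).
Hypothesis closed_ker : closed [set x | pi x = 1].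

Lemma closed_equalizer (T : topologicalType) (f g : T -> G) :
  continuous f -> continuous g -> closed [set x | pi (f x) = pi (g x)].
Proof.
move=> cf cg.
have -> : [set x | pi (f x) = pi (g x)] =
    (fun x => (f x)^-1 * g x) @^-1` [set x | pi x = 1].
  apply/seteqP; split=> x /=; rewrite gmulfM gmulfV.
    by move=> ->; rewrite mulVg.
  by move=> /mulg1_eq; rewrite invgK.
move: closed_ker; apply: (continuous_closedP _).1.
by apply: continuous_mulg => //; apply: continuous_invg.
Qed.

Lemma near_distinct (T : topologicalType) (f g : T -> G) (t : T) :
  continuous f -> continuous g -> pi (f t) <> pi (g t) ->
  \forall x \near t, pi (f x) <> pi (g x).
Proof.
move=> cf cg nfg; apply: open_nbhs_nbhs; split=> //.
exact/closed_openC/closed_equalizer.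
Qed.

(** The elements whose images have fewer than [n] conjugates. Quantifying over
    tuples of conjugating elements makes the set visibly closed. *)
Definition few_conjugates n : set G :=
  [set a | forall y : 'I_n -> G, exists i j, i != j /\ pi (a ^ y i) = pi (a ^ y j)].

Lemma closed_few_conjugates n : closed (few_conjugates n).
Proof.
have -> : few_conjugates n = \bigcap_(y in [set: 'I_n -> G])
    \bigcup_(p in [set p : 'I_n * 'I_n | p.1 != p.2])
      [set a | pi (a ^ y p.1) = pi (a ^ y p.2)].
  apply/seteqP; split=> a.
    by move=> aE y _; have [i [j [nij eij]]] := aE y; exists (i, j).
  by move=> aE y; have [[i j] nij eij] := aE y I; exists i, j.
apply: closed_bigI => y _; apply: closed_bigcup => [|p _].
  exact: finite_finset.
by apply: closed_equalizer; apply: continuous_conjg => //;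
  (exact: continuous_const || (move=> a; exact: cvg_id)).
Qed.

Hypothesis nbhs_cent : forall x, nbhs 1 [set y | commute (pi x) (pi y)].

(** Conjugates of [a] are indexed by the cosets of its centralizer, which are
    finitely many. The conjugators are inverted because [syndetic] speaks of
    left translates. *)
Lemma few_conjugates_cover a : exists n, few_conjugates n a.
Proof.
have [s sP] := compact_syndetic Gcompact (nbhs_cent a).
exists (size s).+1 => y.
have /choice[t tP] : forall i, exists t, t \in s /\ commute (pi a) (pi (t^-1 * (y i)^-1)).
  by move=> i; have [t ? ?] := sP (y i)^-1; exists t.
have [|i [j [nij et]]] := @seq_pigeonhole 'I_(size s).+1 _ t s (fun i => (tP i).1).
  by rewrite card_ord.
exists i, j; split=> //.
suff conjE k : pi (a ^ y k) = pi (a ^ (t k)^-1) by rewrite !conjE et.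
have -> : (t k)^-1 = (t k)^-1 * (y k)^-1 * y k by rewrite mulgVK.
rewrite conjgM [RHS]gmulfJ [pi (a ^ (_ * _))]gmulfJ.
by have /commgP/conjg_fixP-> := (tP k).2; rewrite -gmulfJ.
Qed.

(** Let [n.+1] be the least index for which [few_conjugates] has interior, and
    [a] a point of that interior outside [few_conjugates n]. Then [a] has exactly
    [n] conjugates [a ^ y i], and for [b] near [a] the [b ^ y i] are still
    distinct, so they are all the conjugates of [b]. Let [a ^ y i0] be the
    conjugate that equals [a]. By continuity [b ^ x], for [x] near 1, and [b]
    itself are different from all the other [b ^ y j], so both are equal
    to [b ^ y i0]. *)
Lemma nbhs_commuting : exists a : G,
  nbhs (a, 1 : G) [set p : G * G | commute (pi p.1) (pi p.2)].
Proof.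
have [n0 En0] := compact_baire (1 : G) Gcompact Ghausdorff closed_few_conjugates
  few_conjugates_cover.
have [] := @ex_minnP (fun n => `[<(few_conjugates n)° !=set0>]).
  by exists n0; apply/asboolP.
case=> [|n] /asboolP[a0 a0E] nmin.
  by have /(_ (fun=> 1))[[]] : few_conjugates 0 a0 by exact: interior_subset.
have [a aE nEa] : exists2 a, (few_conjugates n.+1)° a & ~ few_conjugates n a.
  apply: contrapT => noa; suff: n < n by rewrite ltnn.
  apply: nmin; apply/asboolP; exists a0.
  have nE : nbhs a0 (few_conjugates n.+1)°.
    by apply: open_nbhs_nbhs; split=> //; exact: open_interior.
  apply: (@filterS _ (nbhs a0) _ _ _ _ nE) => b bE.
  by apply: contrapT => nEb; apply: noa; exists b.
have [y yP] : exists y : 'I_n -> G, forall i j, i != j -> pi (a ^ y i) <> pi (a ^ y j).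
  apply: contrapT => noy; apply: nEa => y; apply: contrapT => nij; apply: noy.
  by exists y => i j ij eij; apply: nij; exists i, j.
have conj_y b x : few_conjugates n.+1 b ->
    (forall p : 'I_n * 'I_n, p.1 != p.2 -> pi (b ^ y p.1) <> pi (b ^ y p.2)) ->
    exists i, pi (b ^ x) = pi (b ^ y i).
  (* Were [b ^ x] a new conjugate, there would be [n.+1] of them. *)
  move=> bE byP; have [k [l []]] := bE (fun k => oapp y x (unlift ord0 k)).
  case: (unliftP ord0 k) => [i ->|->]; case: (unliftP ord0 l) => [j ->|->] //=.
  - move=> nij; rewrite (inj_eq lift_inj) in nij.
    by move/(byP (i, j) nij).
  - by exists i.
  - by exists j.
have [i0 ai0] : exists i, pi (a ^ 1) = pi (a ^ y i).
  by apply: conj_y => [|p]; [exact: interior_subset | exact: yP].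
have c1 : continuous (fun p : G * G => p.1) by move=> p; exact: cvg_fst.
have c2 : continuous (fun p : G * G => p.2) by move=> p; exact: cvg_snd.
have cc (z : G) : continuous (fun p : G * G => p.1 ^ z).
  by apply: continuous_conjg => // p; exact: cvg_cst.
have near_E : \forall p \near (a, 1 : G), few_conjugates n.+1 p.1 by exact: (c1 (a, 1)).
have near_y : \forall p \near (a, 1 : G), forall q : 'I_n * 'I_n,
    q.1 != q.2 -> pi (p.1 ^ y q.1) <> pi (p.1 ^ y q.2).
  apply: (@filter_forall _ _ (fun (q : 'I_n * 'I_n) (p : G * G) =>
    q.1 != q.2 -> pi (p.1 ^ y q.1) <> pi (p.1 ^ y q.2)) _
    (nbhs_filter (a, 1 : G))) => q.
  have [_|nq] := eqVneq q.1 q.2; first exact: filterE.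
  have nayq : pi ((a, 1 : G).1 ^ y q.1) <> pi ((a, 1 : G).1 ^ y q.2) by exact: yP.
  by apply: filterS (near_distinct (cc (y q.1)) (cc (y q.2)) nayq) => p + _.
have near_i0 : \forall p \near (a, 1 : G), forall j, j != i0 ->
    pi (p.1 ^ p.2) <> pi (p.1 ^ y j).
  apply: (@filter_forall _ _ (fun j (p : G * G) =>
    j != i0 -> pi (p.1 ^ p.2) <> pi (p.1 ^ y j)) _
    (nbhs_filter (a, 1 : G))) => j.
  have [_|nj] := eqVneq j i0; first exact: filterE.
  have naj : pi ((a, 1 : G).1 ^ (a, 1 : G).2) <> pi ((a, 1 : G).1 ^ y j).
    by rewrite /= ai0 => /yP; apply; rewrite eq_sym.
  by apply: filterS (near_distinct (continuous_conjg c1 c2) (cc (y j)) naj) => p + _.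
have near_11 : \forall p \near (a, 1 : G), forall j, j != i0 ->
    pi (p.1 ^ 1) <> pi (p.1 ^ y j).
  have c11 : continuous (fun p : G * G => (p.1, 1 : G)).
    by move=> p; apply: cvg_pair; [exact: cvg_fst | exact: cvg_cst].
  exact: (c11 (a, 1 : G) _ near_i0).
exists a; near=> p.
have pE : few_conjugates n.+1 p.1 by near: p.
have py q : q.1 != q.2 -> pi (p.1 ^ y q.1) <> pi (p.1 ^ y q.2) by move: q; near: p.
have i0P x : (forall j, j != i0 -> pi (p.1 ^ x) <> pi (p.1 ^ y j)) ->
    pi (p.1 ^ x) = pi (p.1 ^ y i0).
  move=> xP; have [j ej] := conj_y p.1 x pE py.
  by have [<-//|/xP] := eqVneq j i0.
have e1 : pi (p.1 ^ 1) = pi (p.1 ^ y i0) by apply: i0P; near: p.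
have e2 : pi (p.1 ^ p.2) = pi (p.1 ^ y i0) by apply: i0P; near: p.
by apply/commgP; rewrite -conjg_fix -gmulfJ e2 -e1 conjg1.
Unshelve. all: by end_near. Qed.

(** If a neighbourhood [A] of [a] commutes with a neighbourhood [B] of 1, so does
    [a^-1 A], a neighbourhood of 1. Finitely many translates [t B] cover the
    group, and commuting with the elements [t] is an open condition. *)
Lemma nbhs_center : nbhs 1 [set x | forall y, commute (pi x) (pi y)].
Proof.
have [a [[A B] /= [aA B1] AB]] := nbhs_commuting.
have [s sP] := compact_syndetic Gcompact B1.
have A1 : nbhs 1 [set x | A (a * x)].
  have := @continuous_mulg _ _ _ (@continuous_const _ a) (fun=> @cvg_id _ _) 1 A.
  by apply; rewrite mulg1.
have s1 : nbhs 1 [set x | forall t, t \in s -> commute (pi t) (pi x)].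
  elim: (s) => [|t r IHr]; first exact: filterE.
  apply: filterS (filterI (nbhs_cent t) IHr) => x [tx rx] u.
  by rewrite inE => /predU1P[->|/rx].
apply: filterS (filterI A1 s1) => x [Ax sx] y.
have [t ts Bt] := sP y.
rewrite -(mulVKg t y) gmulfM; apply: commuteM; first exact/commute_sym/sx.
rewrite -(mulKg a x) gmulfM gmulfV; apply/commute_sym/commuteM; last first.
  exact/commute_sym/(AB (a * x, t^-1 * y)).
apply/commuteV/commute_sym/(AB (a, t^-1 * y)).
by split=> //=; exact: nbhs_singleton.
Qed.

End FC.

End TopologicalGroup.

Theorem theorem1p5 (k : nat) (k_ge1 : 1 <= k)
    (G : topologicalGroupType) (G_profinite : profinite G)
    (finite_comms : forall x : G, finite_set (left_comms k x)) :
  finite_set (lower_central G k.+1).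
Proof.
case: k k_ge1 finite_comms => // n _ finite_comms.
have [Gcompact Ghausdorff _] := G_profinite.
have [Q [pi [_ piP]]] := quotient_exists (upper_central_normal G n).
have commP (x y : G) : commute (pi x) (pi y) <-> upper_central G n [~ x, y].
  by rewrite -piP gmulfR; split=> [/commgP/eqP|/eqP/commgP].
apply: sub_finite_set (@lower_central_sub G n.+1) _.
apply: finite_lower_series.
apply: compact_syndetic => //.
have piC : nbhs (1 : G) [set x | forall y, commute (pi x) (pi y)].
  apply: nbhs_center => // [|x].
    congr closed: (@closed_upper_central _ n Ghausdorff).
    by apply/seteqP; split=> x /piP.
  have := nbhs_centralizer Gcompact Ghausdorff (finite_comms x).
  by apply: filterS => y /commP.
by apply: filterS piC => x xC y; apply/commP.
Qed.
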